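(* For odd $n\ge 3$, let $G_n$ be the graph with vertex set $V_n=\{v^0_0,v^0_1\}\cup\{v^i_0,v^i_1,v^i_2,v^i_3: 1\le i\le n\}$ and edge set $E_n^0\cup E_n^1$, where $E_n^0=\{v^0_0v^0_1\}\cup\{v^i_1v^i_0,v^i_1v^i_2,v^i_1v^i_3,v^i_2v^i_3: 1\le i\le n\}$ and $E_n^1=\{v^i_0v^{i+1}_2,\ v^i_3v^{i+1}_0: 0\le i\le n\}$, where upper indices are taken modulo $n+1$ and we set $v^0_2:=v^0_1$ and $v^0_3:=v^0_1$. Let $\mathcal{G}'=\{G_n: n\ge 3\text{ odd}\}$. Then for every $G\in\mathcal{G}'$, $\chi_i(G)=5$.
   Context: All graphs are simple. An injective $k$-colouring of $G$ is a map $c:V(G)\to\{1,\dots,k\}$ such that any two distinct vertices with a common neighbour get different colours; the injective chromatic number $\chi_i(G)$ is the least such $k$. *)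

(* Defs.v *)
From mathcomp Require Import all_boot.
Set Implicit Arguments.
Unset Strict Implicit.
Unset Printing Implicit Defensive.

Record sgraph := SGraph {
  svertex :> finType;
  sedge : rel svertex;
  sedge_sym : symmetric sedge;
  sedge_irr : irreflexive sedge }.

Section InjectiveColouring.
Variable G : sgraph.

Definition common_neighbour (x y : G) : bool :=
  [exists z : G, sedge x z && sedge y z].

(* The colour set {1, ..., k} is represented by 'I_k = {0, ..., k - 1}. *)
Definition injective_colouring (k : nat) (c : {ffun G -> 'I_k}) : bool :=
  [forall x : G, forall y : G,
     (x != y) && common_neighbour x y ==> (c x != c y)].

Definition inj_colourable (k : nat) : bool :=
  [exists c : {ffun G -> 'I_k}, injective_colouring c].

Lemma ex_inj_colourable : exists k, inj_colourable k.
Proof.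
exists #|G|; apply/existsP; exists [ffun x => enum_rank x].
apply/forallP => x; apply/forallP => y; apply/implyP => /andP[xNy _].
by rewrite !ffunE (inj_eq enum_rank_inj).
Qed.

Definition inj_chromatic_number : nat := ex_minn ex_inj_colourable.

End InjectiveColouring.

Section GraphGn.
Variable n : nat.

(* The pair (i, j) stands for v^i_j: j ranges over {0, 1} when i = 0 and over
   {0, 1, 2, 3} when 1 <= i <= n. *)
Definition Gn_vertex : finType :=
  {p : 'I_n.+1 * 'I_4 | (p.1 == ord0) ==> (p.2 < 2)}.

(* [v i j] is v^i_j for j <= 3 and arbitrary i, where i is read modulo n + 1
   and v^0_2 = v^0_3 = v^0_1. *)
Definition v_pair (i j : nat) : 'I_n.+1 * 'I_4 :=
  (inord (i %% n.+1), inord (if i %% n.+1 == 0 then minn j 1 else j)).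

Lemma v_pairP i j : ((v_pair i j).1 == ord0) ==> ((v_pair i j).2 < 2).
Proof.
apply/implyP; rewrite /v_pair /= -val_eqE /= inordK ?ltn_mod // => ->.
have jle1 := geq_minr j 1.
by rewrite inordK ?ltnS // (leq_trans jle1).
Qed.

Definition v (i j : nat) : Gn_vertex := exist _ (v_pair i j) (v_pairP i j).

Definition En0 : {set {set Gn_vertex}} :=
  [set v 0 0; v 0 1] |:
  \bigcup_(i < n.+1 | 0 < i)
    [set [set v i 1; v i 0]; [set v i 1; v i 2];
         [set v i 1; v i 3]; [set v i 2; v i 3]].

Definition En1 : {set {set Gn_vertex}} :=
  \bigcup_(i < n.+1)
    [set [set v i 0; v i.+1 2]; [set v i 3; v i.+1 0]].

Definition Gn_edge : rel Gn_vertex :=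
  fun x y => [set x; y] \in En0 :|: En1.

Lemma Gn_edge_sym : symmetric Gn_edge.
Proof. by move=> x y; rewrite /Gn_edge setUC. Qed.

Lemma v_neq (i : 'I_n.+1) j j' : 0 < i -> j < 4 -> j' < 4 -> j != j' ->
  v i j != v i j'.
Proof.
move=> i_gt0 lt_j lt_j' neq_j; rewrite -val_eqE /= /v_pair xpair_eqE eqxx /=.
by rewrite modn_small // (negPf (lt0n_neq0 i_gt0)) -val_eqE /= !inordK.
Qed.

Lemma v0_neq i i' j : 0 < j < 4 -> v i 0 != v i' j.
Proof.
case/andP=> j_gt0 lt_j; rewrite -val_eqE /= /v_pair xpair_eqE negb_and.
apply/orP; right; rewrite min0n if_same -val_eqE /= !inordK //.
  by case: ifP => _; case: j j_gt0 {lt_j}.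
by case: ifP => // _; apply: leq_ltn_trans (geq_minl _ _) lt_j.
Qed.

Lemma set1_neq2 (x a b : Gn_vertex) : a != b -> ([set x] == [set a; b]) = false.
Proof.
move=> neq_ab; apply/eqP => /(congr1 (fun A : {set Gn_vertex} => #|A|)).
by rewrite cards1 cards2 neq_ab.
Qed.

Lemma Gn_edge_irr : irreflexive Gn_edge.
Proof.
move=> x; apply/negbTE; rewrite /Gn_edge setUid !inE.
rewrite set1_neq2 ?v0_neq //=; apply/norP; split.
  apply/bigcupP => -[i i_gt0]; rewrite !inE !set1_neq2 ?v_neq //.
apply/bigcupP => -[i _]; rewrite !inE !set1_neq2 ?v0_neq //.
by rewrite eq_sym v0_neq.
Qed.

Definition Gn : sgraph := SGraph Gn_edge_sym Gn_edge_irr.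

End GraphGn.

Definition family_G' (G : sgraph) : Prop :=
  exists n : nat, [/\ 3 <= n, odd n & G = Gn n].

(* Main.v *)
(* Write x_i, a_i, b_i, c_i for the colours of v^i_0, v^i_1, v^i_2, v^i_3 in an
   injective 4-colouring. For 1 <= i < n, x_i = a_i iff x_{i+1} = a_{i+1}. If
   x_1 = a_1, then a_{i+2} = a_i for all i, and since n is odd
   x_n = a_n = a_1 = x_1, although v^1_0 and v^n_0 are both adjacent to v^0_1.
   Otherwise each of blocks 1 and n uses all four colours, which forces
   b_1 = x_0 = c_n, although v^1_2 and v^n_3 are both adjacent to v^0_0.
   A 5-colouring is (x_0, a_0) = (2, 0), (x_n, a_n, b_n, c_n) = (3, 1, 0, 4) and
   (x_i, a_i, b_i, c_i) = (0, 1, 2, 3) for 0 < i < n. *)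
Require Import Defs.
From mathcomp Require Import all_boot.
From mathcomp Require Import zify.

Lemma uniq3P (T : eqType) (x y z : T) :
  reflect [/\ x != y, x != z & y != z] (uniq [:: x; y; z]).
Proof.
rewrite /= !inE negb_or andbT.
by apply: (iffP andP) => [[/andP[-> ->] ->] | [-> -> ->]].
Qed.

(** Otherwise ['I_4] would contain five distinct colours. *)
Lemma fourth_colour (a b c d e : 'I_4) :
  uniq [:: a; b; c; d] -> uniq [:: e; b; c; d] -> e = a.
Proof.
move=> uabcd uebcd; apply/eqP; apply: contraT => ea.
have /card_uniqP/= u5 : uniq [:: e; a; b; c; d].
  by rewrite cons_uniq uabcd inE (negPf ea) andbT; case/andP: uebcd.
by have := max_card [in [:: e; a; b; c; d]]; rewrite u5 card_ord.
Qed.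

Ltac uniq_from_context :=
  rewrite /= ?inE ?negb_or; do ?[apply/andP; split];
  (done || by rewrite eq_sym).

(** * Impossibility of four colours, for an abstract array of colours *)

Section FourColours.

(** [f i j] stands for the colour of v^i_j, with [i] not reduced. [rainbow0] to [rainbow3] concern
    the neighbours of v^{i+1}_0 to v^{i+1}_3, and [rainbow00], [rainbow01] those of v^0_0, v^0_1. *)
Variables (n : nat) (f : nat -> nat -> 'I_4).
Hypothesis n_odd : odd n.
Hypothesis f_last : f n.+1 0 = f 0 0.
Hypothesis rainbow0 :
  forall i, i < n -> uniq [:: f i.+1 1; f i.+2 2; f i 3].
Hypothesis rainbow1 :
  forall i, i < n -> uniq [:: f i.+1 0; f i.+1 2; f i.+1 3].
Hypothesis rainbow2 :
  forall i, i < n -> uniq [:: f i.+1 1; f i.+1 3; f i 0].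
Hypothesis rainbow3 :
  forall i, i < n -> uniq [:: f i.+1 1; f i.+1 2; f i.+2 0].
Hypothesis rainbow00 : uniq [:: f 0 1; f 1 2; f n 3].
Hypothesis rainbow01 : uniq [:: f 0 0; f 1 0; f n 0].

Let eq01 i := f i 0 == f i 1.

(* If f i 0 = f i 1, then this colour is the one missing from the triangles of
   both neighbouring blocks. *)
Lemma next_missing i : i.+1 < n -> eq01 i.+1 ->
  uniq [:: f i.+1 1; f i.+2 1; f i.+2 2; f i.+2 3].
Proof.
move=> lt_in /eqP e.
move: (rainbow0 i (ltnW lt_in)) (rainbow1 _ lt_in) (rainbow2 _ lt_in).
rewrite e => /uniq3P[? _ _] /uniq3P[_ _ ?] /uniq3P[? ? ?].
have /uniq3P[? _ _] := rainbow3 _ lt_in; uniq_from_context.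
Qed.

Lemma prev_missing i : i.+1 < n -> eq01 i.+2 ->
  uniq [:: f i.+2 1; f i.+1 1; f i.+1 2; f i.+1 3].
Proof.
move=> lt_in /eqP e; have lt_in' := ltnW lt_in.
move: (rainbow0 _ lt_in) (rainbow1 _ lt_in') (rainbow3 _ lt_in').
rewrite e => /uniq3P[_ ? _] /uniq3P[_ _ ?] /uniq3P[? ? ?].
have /uniq3P[? _ _] := rainbow2 _ lt_in'; uniq_from_context.
Qed.

(** From left to right, x_{i+1} and a_{i+1} both avoid the distinct colours a_{i+2}, b_{i+1},
    c_{i+1}; conversely, x_{i+2} and a_{i+2} both avoid a_{i+1}, b_{i+2}, c_{i+2}. *)
Lemma eq01_step i : i.+1 < n -> eq01 i.+2 = eq01 i.+1.
Proof.
move=> lt_in; have lt_in' := ltnW lt_in.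
have /uniq3P[? ? _] := rainbow1 _ lt_in.
have /uniq3P[? ? ?] := rainbow1 _ lt_in'.
have /uniq3P[_ ? ?] := rainbow2 _ lt_in.
have /uniq3P[_ ? ?] := rainbow3 _ lt_in'.
apply/idP/idP => e.
  have /= := prev_missing _ lt_in e; rewrite !inE !negb_or.
  case/and4P=> /and3P[? ? ?] /andP[? ?] ? _; apply/eqP.
  apply: (@fourth_colour _ (f i.+2 1) (f i.+1 2) (f i.+1 3)).
    uniq_from_context.
  uniq_from_context.
have /= := next_missing _ lt_in e; rewrite !inE !negb_or.
case/and4P=> /and3P[? ? ?] /andP[? ?] ? _; apply/eqP.
apply: (@fourth_colour _ (f i.+1 1) (f i.+2 2) (f i.+2 3)).
  uniq_from_context.
uniq_from_context.
Qed.

Lemma eq01_first i : i < n -> eq01 i.+1 = eq01 1.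
Proof. by elim: i => // i IHi lt_in; rewrite eq01_step // IHi // ltnW. Qed.

(** Both are the colour missing from the triangle of block [i.+2]. *)
Lemma colour1_period i : i.+2 < n -> eq01 1 -> f i.+3 1 = f i.+1 1.
Proof.
move=> lt_in e1; have lt_i1n := ltnW lt_in.
apply: (@fourth_colour _ (f i.+2 1) (f i.+2 2) (f i.+2 3)).
  by apply: next_missing => //; rewrite eq01_first // ltnW.
by apply: prev_missing => //; rewrite eq01_first.
Qed.

Lemma colour1_odd k : k.*2 < n -> eq01 1 -> f k.*2.+1 1 = f 1 1.
Proof.
elim: k => // k IHk lt_kn e1.
by rewrite doubleS colour1_period // IHk // ltnW // ltnW.
Qed.

Lemma no_four_colours : False.
Proof.
have lt_mn : n.-1 < n by case: n n_odd.
have n_gt0 : 0 < n by case: n n_odd.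
have def_n : n.-1.+1 = n by rewrite prednK.
have := eq01_first _ lt_mn; rewrite def_n => en.
have [/uniq3P[_ _ bc] /uniq3P[? ? x1n]] := (rainbow00, rainbow01).
have [e1|ne1] := boolP (eq01 1).
  (* Oddness enters here: period two carries a_1 to a_n. *)
  have def_n2 : n./2.*2.+1 = n by rewrite -[RHS]odd_double_half n_odd.
  have := colour1_odd n./2; rewrite def_n2 => /(_ (leqnn n) e1) an1.
  move/eqP: x1n; case; have /eqP-> := e1.
  by move: e1; rewrite -en => /eqP->.
move: en; rewrite (negPf ne1) => /negbT nen; case/eqP: bc.
move: ne1 nen; rewrite /eq01 => ne1 nen.
(* x_0 and b_1 both avoid the distinct colours x_1, a_1, c_1; likewise x_0 and c_n both avoid x_n,
   a_n, b_n. *)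
transitivity (f 0 0).
  have /uniq3P[? ? ?] := rainbow1 _ n_gt0.
  have /uniq3P[? ? ?] := rainbow2 _ n_gt0.
  have /uniq3P[? _ _] := rainbow3 _ n_gt0.
  apply: (@fourth_colour _ (f 1 0) (f 1 1) (f 1 3)); uniq_from_context.
(* Block n + 1 is block 0, so x_0 is the colour of the third neighbour of v^n_3. *)
have := rainbow3 _ lt_mn; rewrite def_n f_last => /uniq3P[? ? ?].
have := rainbow2 _ lt_mn; rewrite def_n => /uniq3P[? _ _].
have := rainbow1 _ lt_mn; rewrite def_n => /uniq3P[? ? ?].
apply: (@fourth_colour _ (f n 0) (f n 1) (f n 2)); uniq_from_context.
Qed.

End FourColours.

(** * General facts on injective colourings *)

Section InjectiveColouringTheory.

Variable G : sgraph.

Lemma inj_colourable_leq k k' :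
  k <= k' -> inj_colourable G k -> inj_colourable G k'.
Proof.
move=> le_kk' /existsP[c /'forall_'forall_implyP cP]; apply/existsP.
exists [ffun x => widen_ord le_kk' (c x)].
apply/'forall_'forall_implyP => x y /cP.
by rewrite !ffunE -!val_eqE.
Qed.

(** Stated for triples because [Gn n] is cubic for n >= 3. *)
Lemma injective_colouring_nbrs k (c : {ffun G -> 'I_k}) (z p q r : G) :
    injective_colouring c ->
    sedge p z -> sedge q z -> sedge r z -> uniq [:: p; q; r] ->
  uniq [:: c p; c q; c r].
Proof.
move=> /'forall_'forall_implyP cP pz qz rz /uniq3P[pq pr qr].
by apply/uniq3P; split; apply: cP; apply/andP; split=> //; apply/existsP;
  exists z; apply/andP.
Qed.

Lemma inj_chromatic_number_eq k :
  inj_colourable G k.+1 -> ~~ inj_colourable G k ->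
  inj_chromatic_number G = k.+1.
Proof.
rewrite /inj_chromatic_number => Gk1 nGk; case: ex_minnP => m Gm min_m.
apply/anti_leq; rewrite min_m //= ltnNge; apply: contra nGk => le_mk.
exact: inj_colourable_leq Gm.
Qed.

End InjectiveColouringTheory.

(** * Coincidences, distinctness and adjacency of the vertices v^i_j *)

Section Vertices.

Variable n : nat.
Local Notation v := (v n).

Lemma v_wrap j : v n.+1 j = v 0 j.
Proof. by apply: val_inj; rewrite /= /v_pair modnn mod0n. Qed.

Lemma v0_wrap j : 0 < j -> v 0 j = v 0 1.
Proof. by case: j => // j _; apply: val_inj; rewrite /= /v_pair mod0n. Qed.

(** The shift [d] is nonzero modulo n + 1. This form also covers pairs that wrap around to block
    0. *)
Lemma v_neq_block i d j j' : 0 < d <= n -> v i j != v (i + d) j'.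
Proof.
case/andP=> d_gt0 le_dn; apply/eqP => /(congr1 val)/(congr1 fst)/(congr1 val).
rewrite /= !inordK ?ltn_mod // => /eqP.
rewrite -[X in X %% _ == _]addn0 eqn_modDl mod0n modn_small // eq_sym -leqn0.
by rewrite leqNgt d_gt0.
Qed.

Lemma v_neq_same i j j' : i < n -> j < 4 -> j' < 4 -> j != j' ->
  v i.+1 j != v i.+1 j'.
Proof. by move=> lt_in; apply: (@v_neq n (Ordinal (lt_in : i.+1 < n.+1))). Qed.

Lemma edge00_01 : Gn_edge (v 0 0) (v 0 1).
Proof. by rewrite /Gn_edge; apply/setUP; left; apply: setU11. Qed.

Lemma edge_block i j j' : i < n ->
    (j, j') \in [:: (1, 0); (1, 2); (1, 3); (2, 3)] ->
  Gn_edge (v i.+1 j) (v i.+1 j').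
Proof.
move=> lt_in jj'; rewrite /Gn_edge; apply/setUP; left; apply/setUP; right.
apply/bigcupP.
exists (Ordinal (lt_in : i.+1 < n.+1)) => //=.
by move: jj'; rewrite !inE => /or4P[] /eqP[-> ->]; rewrite eqxx ?orbT.
Qed.

Lemma edge_next i j j' : i <= n -> (j, j') \in [:: (0, 2); (3, 0)] ->
  Gn_edge (v i j) (v i.+1 j').
Proof.
move=> le_in jj'; rewrite /Gn_edge; apply/setUP; right; apply/bigcupP.
exists (Ordinal (le_in : i < n.+1)) => //=.
by move: jj'; rewrite !inE => /orP[] /eqP[-> ->]; rewrite eqxx ?orbT.
Qed.

End Vertices.

(** * Lower bound: four colours do not suffice *)

Lemma Gn_not_4_colourable n : 3 <= n -> odd n -> ~~ inj_colourable (Gn n) 4.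
Proof.
move=> n_ge3 n_odd; apply/existsP => -[c cP].
have nbrs := injective_colouring_nbrs _ _ _ _ _ _ _ cP.
have n_gt0 : 0 < n by apply: leq_trans n_ge3.
have neq1 i j j' : v n i j != v n i.+1 j'.
  by rewrite -addn1 v_neq_block.
have neq2 i j j' : v n i j != v n i.+2 j'.
  by rewrite -addn2 v_neq_block //= (ltnW n_ge3).
(* For the neighbourhoods of v^0_0 and v^0_1, where block [n] occurs together with blocks 0 and
   1. *)
have neq_last i j j' : i < 2 -> v n i j != v n n j'.
  move=> i_lt2; have := @v_neq_block n i (n - i) j j'.
  by rewrite subnKC; [apply; lia | lia].
apply: (@no_four_colours n (fun i j => c (v n i j))) => //.
- by rewrite v_wrap.
- move=> i lt_in; apply: (nbrs (v n i.+1 0)).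
  + exact: edge_block.
  + by rewrite sedge_sym; apply: edge_next.
  + by apply: edge_next => //; apply: ltnW.
  + by apply/uniq3P; split; rewrite // eq_sym.
- move=> i lt_in; apply: (nbrs (v n i.+1 1)).
  + by rewrite sedge_sym; apply: edge_block.
  + by rewrite sedge_sym; apply: edge_block.
  + by rewrite sedge_sym; apply: edge_block.
  + by apply/uniq3P; split; apply: v_neq_same.
- move=> i lt_in; apply: (nbrs (v n i.+1 2)).
  + exact: edge_block.
  + by rewrite sedge_sym; apply: edge_block.
  + by apply: edge_next => //; apply: ltnW.
  + by apply/uniq3P; split; rewrite ?v_neq_same // eq_sym.
- move=> i lt_in; apply: (nbrs (v n i.+1 3)).
  + exact: edge_block.
  + exact: edge_block.
  + by rewrite sedge_sym; apply: edge_next.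
  + by apply/uniq3P; split; rewrite ?v_neq_same.
- apply: (nbrs (v n 0 0)).
  + by rewrite sedge_sym; apply: edge00_01.
  + by rewrite sedge_sym; apply: edge_next.
  + by rewrite -v_wrap; apply: edge_next.
  + by apply/uniq3P; split; rewrite ?neq_last.
apply: (nbrs (v n 0 1)).
- exact: edge00_01.
(* To match [edge_next], v^0_1 is renamed v^0_3 here, and v^{n+1}_2 in the next case. *)
- by rewrite sedge_sym -(v0_wrap _ 3) //; apply: edge_next.
- by rewrite -(v0_wrap _ 2) // -v_wrap; apply: edge_next.
by apply/uniq3P; split; rewrite ?neq_last.
Qed.

(** * Upper bound: an explicit colouring with five colours *)

Lemma set2_eq (T : finType) (x y p q : T) : [set x; y] = [set p; q] ->
  (x = p /\ y = q) \/ (x = q /\ y = p).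
Proof.
move=> e; have: [/\ x \in [set p; q], y \in [set p; q],
  p \in [set x; y] & q \in [set x; y]] by rewrite -{1 2}e {3 4}e !set21 !set22.
case=> /set2P[] ? /set2P[] ? /set2P[] ? /set2P[] ?;
  by [left; split; congruence | right; split; congruence].
Qed.

Section FiveColouring.

Variable n : nat.
Hypothesis n_ge3 : 3 <= n.
Local Notation v := (v n).

(* As v^0_2 = v^0_3 = v^0_1, a neighbour in block 0 is recorded with second
   index 0 or 1. *)
Definition nbr_pairs (i j : nat) : seq (nat * nat) :=
  let prev := if i is i'.+1 then i' else n in
  let next := if i == n then 0 else i.+1 in
  match j with
  | 0 => [:: (i, 1); (next, if i == n then 1 else 2);
               (prev, if i == 1 then 1 else 3)]
  | 1 => if i == 0 then [:: (0, 0); (1, 0); (n, 0)]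
         else [:: (i, 0); (i, 2); (i, 3)]
  | 2 => [:: (i, 1); (i, 3); (prev, 0)]
  | _ => [:: (i, 1); (i, 2); (next, 0)]
  end.

(** Since [v] identifies many index pairs, this keeps one canonical pair for each vertex. *)
Definition v_index (i j : nat) := [&& i <= n, j < 4 & (i == 0) ==> (j < 2)].

Lemma v_index_inj i j i' j' :
  v_index i j -> v_index i' j' -> v i j = v i' j' -> i = i' /\ j = j'.
Proof.
have minE k l : (k == 0) ==> (l < 2) -> (if k == 0 then minn l 1 else l) = l.
  by case: eqP => //= _; case: l => [|[]].
case/and3P=> le_in lt_j4 /minE mj /and3P[le_in' lt_j4' /minE mj'].
move/(congr1 val)=> [].
rewrite !modn_small // mj mj' => /(congr1 val); rewrite /= !inordK // => <-.
by move=> /(congr1 val); rewrite /= !inordK.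
Qed.

Let nbr (x y : Gn_vertex n) := exists i j k l : nat,
  [/\ v_index i j, x = v i j, (k, l) \in nbr_pairs i j & y = v k l].

Let nbrI i j k l :
  v_index i j -> (k, l) \in nbr_pairs i j -> nbr (v i j) (v k l).
Proof. by exists i, j, k, l. Qed.

(** The table [nbr_pairs] misses no neighbour, so distinct colours along its rows make a colouring
    injective. *)
Lemma edge_nbr (x y : Gn_vertex n) : Gn_edge x y -> nbr x y.
Proof.
(* Edges are unordered pairs, so each must be found in the table in both directions. *)
suff main p q : nbr p q /\ nbr q p -> [set x; y] = [set p; q] -> nbr x y.
  have n0 : (n == 0) = false by rewrite gtn_eqF // (leq_trans _ n_ge3).
  rewrite /Gn_edge => /setUP[/setU1P[]|/bigcupP[[i lt_in] _]].
  - by apply: main; split; apply: nbrI; rewrite // inE eqxx.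
  - case/bigcupP=> -[[|i] lt_in] //= _; have {}lt_in : i < n := lt_in.
    rewrite !inE -!orbA.
    by case/or4P=> /eqP; apply: main; split; apply: nbrI;
      rewrite /v_index /= ?lt_in ?inE ?eqxx ?orbT.
  (* Edges between blocks n and 0, and then between 0 and 1, are treated apart: there v^0_2 or v^0_3
     must be rewritten as v^0_1. *)
  have [def_i | neq_in] := eqVneq i n.
    by rewrite {i}def_i in lt_in *; rewrite !inE => /orP[] /eqP; apply: main;
      rewrite /= v_wrap ?(v0_wrap _ 2) //; split; apply: nbrI;
      rewrite /v_index /nbr_pairs ?leqnn ?n0 ?eqxx //= ?inE ?eqxx ?orbT.
  have ltin : i < n by rewrite ltn_neqAle neq_in.
  have [def_i | i_neq0] := eqVneq i 0.
    by rewrite {i neq_in}def_i in lt_in ltin *; rewrite !inE => /orP[] /eqP;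
      apply: main; rewrite /= ?(v0_wrap _ 3) //; split; apply: nbrI;
      rewrite /v_index /nbr_pairs ?ltin //= ?[0 == n]eq_sym ?n0
        ?inE ?eqxx ?orbT.
  by rewrite !inE => /orP[] /eqP; apply: main; split; apply: nbrI;
    rewrite /v_index /nbr_pairs /= ?ltin ?(ltnW ltin) ?(negPf i_neq0)
      ?(negPf neq_in) ?eqSS ?(negPf i_neq0) ?inE ?eqxx ?orbT.
by case=> pq qp /set2_eq[[-> ->] | [-> ->]].
Qed.

(** In block 0 all [j > 0] agree, as they name one vertex. For [j < 4], colour 4 occurs only at
    v^n_3. *)
Definition colour (i j : nat) : nat :=
  if i == 0 then if j == 0 then 2 else 0
  else if i == n then nth 0 [:: 3; 1; 0; 4] j
  else j.

(** If blocks i - 1, i, i + 1 lie strictly between 0 and n, then v^i_j sees exactly the colours 0,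
    1, 2, 3 other than [j]. Blocks 0, 1, n - 1 and n are the exceptional cases. *)
Lemma nbr_colours_uniq i j : v_index i j ->
  uniq [seq colour p.1 p.2 | p <- nbr_pairs i j].
Proof.
rewrite /v_index /colour => /and3P[].
case: i => [|[|i]]; case: j => [|[|[|[|j]]]] //= le_in _ _;
  do ?[case: (_ =P n) => //= ?]; do ?[case: eqP => //= ?]; lia.
Qed.

Lemma colour_lt5 i j : j < 4 -> colour i j < 5.
Proof.
rewrite /colour; case: j => [|[|[|[|j]]]] // _;
  by case: (i == 0); case: (i == n).
Qed.

Lemma nbr_pairs_index i j k l : v_index i j -> (k, l) \in nbr_pairs i j ->
  (k <= n) && (l < 4).
Proof.
rewrite /v_index => /and3P[].
case: i => [|i]; case: j => [|[|[|[|j]]]] //= le_in _ _; rewrite !inE;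
  case/or3P=> /eqP[-> ->]; do ?[case: eqP => //= ?]; lia.
Qed.

Definition Gn_colouring : {ffun Gn n -> 'I_5} :=
  [ffun x : Gn_vertex n => inord (colour (val x).1 (val x).2)].

Lemma Gn_colouring_v i j : i <= n -> j < 4 ->
  Gn_colouring (v i j) = colour i j :> nat.
Proof.
move=> le_in lt_j4; have lt_m4 : (if i == 0 then minn j 1 else j) < 4.
  by case: eqP => // _; apply: leq_ltn_trans (geq_minr _ _) _.
rewrite ffunE /= modn_small // !inordK ?colour_lt5 //.
by rewrite /colour; case: eqP => // _; case: j {lt_j4 lt_m4} => [|[]].
Qed.

Lemma Gn_5_colourable : inj_colourable (Gn n) 5.
Proof.
apply/existsP; exists Gn_colouring.
apply/'forall_'forall_implyP => x y /andP[neq_xy /existsP[z /andP[xz yz]]].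
rewrite sedge_sym in xz; rewrite sedge_sym in yz.
have [i [j [k [l [ij zij kl def_x]]]]] := edge_nbr _ _ xz.
have [i' [j' [k' [l' [ij' zij' kl' def_y]]]]] := edge_nbr _ _ yz.
(* Both canonical pairs name [z], so [x] and [y] come from the same row of the table. *)
have [ei ej] := v_index_inj _ _ _ _ ij' ij (etrans (esym zij') zij).
rewrite ei ej in kl'.
apply: contra neq_xy => /eqP/(congr1 val); rewrite def_x def_y /=.
have /andP[le_kn lt_l4] := nbr_pairs_index _ _ _ _ ij kl.
have /andP[le_kn' lt_l4'] := nbr_pairs_index _ _ _ _ ij kl'.
rewrite !Gn_colouring_v // => eq_col.
suff [-> ->] : (k, l) = (k', l') by [].
move: (nbr_colours_uniq _ _ ij); set s := nbr_pairs i j in kl kl' *.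
set f := (fun p => _); move=> uniq_s.
(* The entries are compared by position: as the colours along the row are distinct, equal colours
   force equal positions. *)
rewrite -(nth_index (0, 0) kl) -(nth_index (0, 0) kl'); congr nth.
apply/eqP; rewrite -(nth_uniq 0 _ _ uniq_s) ?size_map ?index_mem //.
by rewrite !(nth_map (0, 0)) ?index_mem // !nth_index //; apply/eqP.
Qed.

End FiveColouring.

Theorem theorem10 (G : sgraph) (hG : family_G' G) : inj_chromatic_number G = 5.
Proof.
case: hG => n [n_ge3 n_odd ->]; apply: inj_chromatic_number_eq.
  exact: Gn_5_colourable.
exact: Gn_not_4_colourable.
Qed.
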